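(* Consider the following algorithm for the gammoid matroid secretary problem with presentation $(G,S,R)$ of exchangeability $\mu$: set $\mathrm{ALG}\gets\emptyset$, $\mathcal{P}\gets\emptyset$, draw $s\sim\mathrm{Bin}(n,p)$; for $i=s+1,\dots,n$: if $r_i\in\mathrm{OPT}(R_i)$ and no vertex of the path $\mathcal{P}_{\mathrm{OPT}(R_i)}(r_i)$ is covered by $\mathcal{P}$, then set $\mathrm{ALG}\gets\mathrm{ALG}+r_i$ and $\mathcal{P}\gets\mathcal{P}\cup\{\mathcal{P}_{\mathrm{OPT}(R_i)}(r_i)\}$; return $\mathrm{ALG}$. This algorithm has forbidden sets of size $\mu$. Consequently, if $\mu$ is known and $p=p(\mu)$, it is $\alpha(\mu)$ probability-competitive.
   Context: Gammoid: $G=(V,E)$ digraph, $S,R\subseteq V$ (not necessarily disjoint); the gammoid $\Gamma(G,S,R)$ has ground set $R$ (the terminals), $|R|=n$, and $X\subseteq R$ is independent iff there are pairwise node-disjoint directed paths each starting in $S$, one ending at each element of $X$. For each independent $X$ a canonical such collection $\mathcal{P}_X$ is fixed, not depending on the arrival order (only on the minimal subgraph containing all arcs of all $S$-$X$ paths); $\mathcal{P}_X(v)$ is the path of $\mathcal{P}_X$ ending at $v$; a collection $\mathcal{P}$ covers a vertex if it lies on one of its paths. Exchangeability $\mu$: the maximum, over independent $X$ and directed $S$-$r$ paths $Q$ with $r\in R\setminus X$, of the number of paths of $\mathcal{P}_X$ intersected by $Q$. Ordinal MSP setting: total order $\succ$ on $R$; $\mathrm{OPT}(Q)$ is the greedy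 (lexicographically maximum w.r.t. $\succ$) base of $Q\subseteq R$, $\mathrm{OPT}=\mathrm{OPT}(R)$; terminals arrive in uniformly random order $r_1,\dots,r_n$, $R_t=\{r_1,\dots,r_t\}$; on arrival of $r_i$ the paths from $S$ to $r_i$ are revealed. Probability-competitive: $\Pr(e\in\mathrm{ALG})\ge1/\alpha$ for all $e\in\mathrm{OPT}$. Forbidden sets of size $k$: (1) output always independent; (2) draws $s\sim\mathrm{Bin}(n,p)$ and accepts none of the first $s$ elements; (3) for every $(X,Y,r^* )$ with $Y\subseteq R$, $r^*\in\mathrm{OPT}(Y)$, $X\subseteq Y\setminus\{r^*\}$ there is $\mathcal{F}(X,Y,r^* )\subseteq X$ with $|\mathcal{F}(X,Y,r^* )|\le k$ such that for every $t\ge s+1$, if $r_t\in\mathrm{OPT}(R_t)$ and $r_j\notin\mathcal{F}(R_j,R_t,r_t)$ for all $j\in\{s+1,\dots,t-1\}$ then $r_t$ is selected. $(p(1),\alpha(1))=(1/e,e)$; for $k\ge2$, $(p(k),\alpha(k))=(k^{-1/(k-1)},k^{k/(k-1)})$. *)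

(* Defs.v *)
From HB Require Import structures.
From mathcomp Require Import all_boot all_order all_algebra.
From mathcomp Require Import all_classical all_reals all_analysis.

Set Implicit Arguments.
Unset Strict Implicit.
Unset Printing Implicit Defensive.

Import Order.TTheory GRing.Theory Num.Theory.
Local Open Scope ring_scope.

Section Gammoid.
Context {V : finType}.
Implicit Types (e : rel V) (S R X : {set V}) (r v : V).

(* Directed paths are given by their vertex lists and do not repeat vertices,
   so they have at most #|V| vertices and form a finite type.  A single vertex
   is a path of length 0 (S and R may overlap). *)
Definition vpath := #|V|.-bseq V.

Definition dipath e S v (Q : vpath) : bool :=
  match (Q : seq V) with
  | [::] => false
  | x :: q => [&& x \in S, path e x q, uniq (x :: q) & last x q == v]
  end.

Definition linkage e S X (L : V -> vpath) : bool :=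
  [forall v in X, dipath e S v (L v)] &&
  [forall u in X, forall v in X, (u != v) ==> [disjoint L u & L v]].

Definition gammoid_indep e S R X : bool :=
  (X \subset R) && [exists L : {ffun V -> vpath}, linkage e S X L].

Definition path_arcs e S X : {set V * V} :=
  [set a | [exists v in X, exists Q : vpath,
              dipath e S v Q && (a \in zip Q (behead Q))]].

(* A rule for choosing linkages sees only the subgraph of all arcs of S-X
   paths, and the set X itself. *)
Definition linkage_rule := {set V * V} -> {set V} -> V -> vpath.

Definition canonical_path e S (rule : linkage_rule) X v : vpath :=
  rule (path_arcs e S X) X v.

Definition is_canonical e S R (rule : linkage_rule) : Prop :=
  forall X, gammoid_indep e S R X -> linkage e S X (canonical_path e S rule X).

(* The paths of the linkage of X are counted by their (distinct) ends. *)
Definition exchangeability e S R (rule : linkage_rule) : nat :=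
  \max_(X : {set V} | gammoid_indep e S R X)
    \max_(r in R :\: X)
      \max_(Q : vpath | dipath e S r Q)
        #|[set v in X | ~~ [disjoint canonical_path e S rule X v & Q]]|.

End Gammoid.

Arguments vpath V : clear implicits.
Arguments linkage_rule V : clear implicits.

Section Secretary.
Context {V : finType}.
Implicit Types (R X Y Q : {set V}) (geR : rel V) (indep : pred {set V}).

(* geR x y means that x = y or x is preferred to y. *)
Definition total_order_on R geR : Prop :=
  [/\ {in R, reflexive geR}, {in R &, antisymmetric geR},
      {in R & &, transitive geR} & {in R &, total geR}].

Definition OPT indep geR Q : {set V} :=
  foldl (fun B x => if indep (x |: B) then x |: B else B) finset.set0
        (sort geR (enum Q)).

Definition arrival_orders R : {set #|R|.-tuple V} :=
  [set w : #|R|.-tuple V | perm_eq w (enum R)].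

Definition arrived n (w : n.-tuple V) (t : nat) : {set V} :=
  [set x in take t w].

(* An algorithm whose only random choice is the sample size s; run s w is its
   output on sample size s and arrival order w. *)
Record algorithm (K : realType) (n : nat) := Algorithm {
  sample_law : probability nat K;
  run : nat -> n.-tuple V -> {set V} }.

(* The probability that r is selected, for a uniformly random arrival order
   and an independent sample size. *)
Definition select_prob (K : realType) R (A : algorithm K #|R|) (r : V) :
    \bar K :=
  ((#|arrival_orders R|%:R^-1)%:E *
   \sum_(w in arrival_orders R)
      sample_law A [set s : nat | r \in run A s w]%classic)%E.

Definition prob_competitive (K : realType) R indep geR (A : algorithm K #|R|)
    (alpha : K) : Prop :=
  forall r, r \in OPT indep geR R -> ((1 / alpha)%:E <= select_prob A r)%E.

(* Positions are counted from 0: the element at position i, tnth w i, arrives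
   at time i + 1, and it lies outside the sample exactly when s <= i. *)
Definition has_forbidden_sets (K : realType) R indep geR (p : K) (k : nat)
    (A : algorithm K #|R|) : Prop :=
  [/\ forall s w, w \in arrival_orders R -> indep (run A s w),
      (forall U, sample_law A U = binomial_prob #|R| p U) /\
      (forall s w (i : 'I_#|R|), w \in arrival_orders R -> (i < s)%N ->
         tnth w i \notin run A s w) &
      exists F : {set V} -> {set V} -> V -> {set V},
        (forall X Y r, Y \subset R -> r \in OPT indep geR Y ->
           X \subset Y :\ r -> F X Y r \subset X /\ (#|F X Y r| <= k)%N) /\
        (forall s w (i : 'I_#|R|), w \in arrival_orders R -> (s <= i)%N ->
           tnth w i \in OPT indep geR (arrived w i.+1) ->
           (forall j : 'I_#|R|, (s <= j < i)%N ->
              tnth w j \notin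
                F (arrived w j.+1) (arrived w i.+1) (tnth w i)) ->
           tnth w i \in run A s w)].

End Secretary.

Section GammoidAlgorithm.
Context {V : finType}.
Variables (e : rel V) (S R : {set V}) (rule : linkage_rule V) (geR : rel V).

(* A state is the pair (ALG, P). *)
Definition gammoid_step (w : #|R|.-tuple V) (st : {set V} * {set vpath V})
    (i : 'I_#|R|) : {set V} * {set vpath V} :=
  let r := tnth w i in
  let B := OPT (gammoid_indep e S R) geR (arrived w i.+1) in
  let Q := canonical_path e S rule B r in
  if (r \in B) && [forall x in Q, forall Q' in st.2, x \notin (Q' : vpath V)]
  then (r |: st.1, Q |: st.2) else st.

Definition gammoid_run (s : nat) (w : #|R|.-tuple V) : {set V} :=
  (foldl (gammoid_step w) (finset.set0, finset.set0)
         [seq i : 'I_#|R| <- enum 'I_#|R| | (s <= i)%N]).1.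

Definition gammoid_alg (K : realType) (p : K) : algorithm K #|R| :=
  Algorithm (binomial_prob #|R| p) gammoid_run.

End GammoidAlgorithm.

(* Meaningful for k >= 1 only. *)
Definition p_opt (K : realType) (k : nat) : K :=
  if k == 1%N then 1 / expR 1 else k%:R `^ (- (1 / (k%:R - 1))).

Definition alpha_opt (K : realType) (k : nat) : K :=
  if k == 1%N then expR 1 else k%:R `^ (k%:R / (k%:R - 1)).

(* Main.v *)
Require Import Defs.
From HB Require Import structures.
From mathcomp Require Import all_boot all_order all_algebra.
From mathcomp Require Import all_classical all_reals all_analysis.
From mathcomp Require Import zify ring.
Import Order.TTheory GRing.Theory Num.Theory.
Local Open Scope ring_scope.

Set Implicit Arguments.
Unset Strict Implicit.
Unset Printing Implicit Defensive.

(* F(X,Y,r) is the set of v in OPT(X) whose canonical path P_OPT(X)(v) meets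
   P_OPT(Y)(r): at most mu of them, and only an earlier arrival r_j in
   F(R_j,R_t,r_t) can block r_t.

   Competitiveness of any algorithm with forbidden sets of size k: gammoids are
   matroids, so r in OPT(R) lies in OPT(R_t) from its arrival on.  Revealing the
   elements before r from the last to the first, the j-th of them avoids its
   forbidden set with probability at least (1 - k/j)^+ given the set of the
   first j.  Averaging over s ~ Bin(n,x) and over the arrival time of r gives a
   success probability of at least f(x)/n for a polynomial f with
   x f' - k f <= - n x.  So f(x)/(n x^k) - H(x) is nonincreasing, where
   H' = - x^(-k) and H(1) = 0, hence f(p)/n >= p^k H(p), and at p = p(k) one has
   H(p) = 1 and p^k = 1/alpha(k). *)

(** * Gammoids are matroids *)

Section GammoidMatroid.
Context {V : finType}.
Implicit Types (e : rel V) (S R X Y I J : {set V}) (f g : {ffun V -> V}).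

Lemma mem_vpath v (Q : vpath V) : (v \in Q) = (v \in bseqval Q).
Proof. by []. Qed.

Lemma dipath_end e S v (Q : vpath V) : dipath e S v Q -> v \in Q.
Proof.
rewrite /dipath mem_vpath; case: (bseqval Q) => [//|x q] /and4P[_ _ _ /eqP <-].
exact: mem_last.
Qed.

Lemma linkage_disjoint {e S X} {L : V -> vpath V} {u v z} :
  linkage e S X L -> u \in X -> v \in X -> z \in L u -> z \in L v -> u = v.
Proof.
case/andP=> _ /forall_inP LP uX vX zu zv; apply/eqP; apply: contraT => neq.
move/forall_inP: (LP u uX) => /(_ v vX) /implyP /(_ neq) /disjointFr /(_ zu).
by rewrite zv.
Qed.

(* X is linked from S iff X avoids the image of such an f: going backwards
   along the paths gives f, and iterating f from X until S is reached gives
   the paths. *)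
Definition dual_matching e S X f :=
  [forall u in ~: S, (f u \notin X) && ((f u == u) || e (f u) u)] &&
  dinjectiveb f (mem (~: S)).

Lemma dual_matchingP e S X f :
  reflect ({in ~: S, forall u, f u \notin X /\ (f u = u \/ e (f u) u)} /\
           {in ~: S &, injective f})
          (dual_matching e S X f).
Proof.
apply: (iffP andP) => -[h /dinjectiveP inj]; split=> //.
  by move=> u uS; move/forall_inP: h => /(_ u uS) /andP[-> /predU1P].
by apply/forall_inP => u /h [-> /predU1P].
Qed.

(** A vertex outside [S] on a path goes to its predecessor, and vertices off all paths are fixed. A
    vertex of [X] ends its own path, so it precedes nothing, and disjointness of the paths makes [f]
    injective. *)
Lemma dual_matching_of_linkage e S X (L : V -> vpath V) :
  linkage e S X L -> exists f, dual_matching e S X f.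
Proof.
move=> LX; have Lend v : v \in X -> v \in L v.
  by case/andP: LX => /forall_inP h _ /h /dipath_end.
pose on u v := (v \in X) && (u \in L v).
pose f := [ffun u => if [pick v | on u v] is Some v
  then nth u (L v) (index u (L v)).-1 else u].
(* A path through [u] starts in [S] while [u] is outside [S], so the index of [u] is positive and
   [.-1] points to a true predecessor. *)
have fP u : u \notin S ->
    (exists2 v, on u v & [/\ nth u (L v) (index u (L v)) = u, (0 < index u (L v))%N,
       f u = nth (f u) (L v) (index u (L v)).-1,
       e (f u) u & v = last v (L v) /\ uniq (L v)])
    \/ (forall v, ~~ on u v) /\ f u = u.
  move=> uS; rewrite /f ffunE; case: pickP => [v /andP[vX uv]|none]; last first.
    by right; split=> // v; rewrite none.
  left; exists v; first by rewrite /on vX.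
  case/andP: LX => /forall_inP /(_ v vX) + _.
  rewrite /dipath mem_vpath in uv *.
  case: (bseqval (L v)) uv => [//|x q] uxq /and4P[xS /(pathP u) pq uq /eqP lq].
  have ux : x != u by apply: contraNneq uS => <-.
  have uq' : u \in q by move: uxq; rewrite inE eq_sym (negbTE ux).
  rewrite [index _ _]/= (negbTE ux) /=; split=> //.
  - by rewrite nth_index.
  - by apply: set_nth_default; rewrite /= ltnS index_size.
  - have := pq (index u q); rewrite index_mem uq' => /(_ isT).
    by rewrite nth_index.
have fon u v : u \notin S -> on u v -> f u \in L v.
  move=> uS uv; case: (fP u uS) => [[v' uv' [_ _ fE _ _]]|[/(_ v)]]; last by rewrite uv.
  have <- : v' = v.
    by case/andP: uv => vX uv; case/andP: uv' => v'X uv'; exact: linkage_disjoint LX _ _ uv' uv.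
  rewrite fE mem_nth //; case/andP: uv' => _; rewrite -index_mem; apply: leq_ltn_trans.
  exact: leq_pred.
exists f; apply/dual_matchingP; split=> [u|u u']; rewrite !inE => uS.
- case: (fP u uS) => [[v uv [ui i0 fE eu [lv uL]]]|[none ->]]; last first.
    split; last by left.
    by apply/negP => uX; move: (none u); rewrite /on uX Lend.
  split; last by right.
  (* If [f u] were in [X], it would be the last vertex of the path through [u], although it sits one
     position before [u]. *)
  apply/negP => fX; have vE : f u = v.
    by apply: linkage_disjoint LX fX _ (Lend _ fX) (fon _ _ uS uv); case/andP: uv.
  have iu : (index u (L v) < size (L v))%N by rewrite index_mem; case/andP: uv.
  move: lv; rewrite -nth_last => /esym lv.
  have : nth v (L v) (index u (L v)).-1 == nth v (L v) (size (L v)).-1.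
    by rewrite lv -{1}vE -fE vE.
  rewrite nth_uniq //; move: (size (L v)) (index u (L v)) i0 iu => a b i0 iu.
  - by move/eqP; lia.
  - by lia.
  - by lia.
- move=> u'S ff'.
  case: (fP u uS) (fP u' u'S) => [[v uv [ui i0 fE eu [lv uL]]]|[none fE]]
     [[v' uv' [ui' i0' fE' eu' _]]|[none' fE']].
  + have vv' : v = v'.
      have /andP[vX _] := uv; have /andP[v'X _] := uv'.
      apply: linkage_disjoint LX vX v'X (fon _ _ uS uv) _; rewrite ff'; exact: fon.
    subst v'; move: fE'; rewrite -ff' {1}fE => /eqP.
    have /andP[_] := uv; rewrite -index_mem => iu.
    have /andP[_] := uv'; rewrite -index_mem => iu'.
    rewrite nth_uniq ?(leq_ltn_trans (leq_pred _)) // => /eqP ii.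
    rewrite -ui -[RHS]ui' -(prednK i0) -(prednK i0') ii prednK //.
    exact: set_nth_default.
  + by move: (none' v); rewrite -fE' -ff' /on fon //; case/andP: uv => ->.
  + by move: (none v'); rewrite -fE ff' /on fon //; case/andP: uv' => ->.
  + by rewrite -fE -fE'.
Qed.

Lemma linkage_of_dual_matching e S X f :
  dual_matching e S X f -> exists L : {ffun V -> vpath V}, linkage e S X L.
Proof.
case/dual_matchingP => fX finj.
(* Two backward walks from [X] meet: cancelling [f] by injectivity brings one back to its start in
   [X], a value [f] never takes outside [S], so the other is at its start too. With [x = y] this
   excludes repetitions on a path; for two ends it gives disjointness. *)
have sync i j x y : x \in X -> y \in X -> (forall i', (i' < i)%N -> iter i' f x \notin S) ->
    (forall j', (j' < j)%N -> iter j' f y \notin S) -> iter i f x = iter j f y -> i = j /\ x = y.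
  move=> xX yX; elim: i j => [|i IH] [|j] //= iS jS.
  - by move=> xE; case: (fX (iter j f y)); rewrite ?inE ?jS // -xE xX.
  - by move=> xE; case: (fX (iter i f x)); rewrite ?inE ?iS // xE yX.
  - move=> fE; have [|||-> ->] // := IH j.
    + by move=> i' /ltnW; exact: iS.
    + by move=> j' /ltnW; exact: jS.
    + by apply: finj => //; rewrite inE ?iS ?jS.
have trU x n : x \in X -> (forall i, (i < n)%N -> iter i f x \notin S) ->
    uniq (traject f x n.+1).
  move=> xX nS; apply/(uniqP x) => i j; rewrite !inE size_traject => iS jS.
  rewrite !nth_traject // => /sync [] // k kn; apply: nS; lia.
(* The first time the walk from [x] meets [S]. It comes within [#|V|] steps, as otherwise the walk
   would have [#|V| + 1] distinct vertices. *)
pose d x := find (mem S) (traject f x #|V|).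
have dS x : x \in X -> iter (d x) f x \in S /\ forall i, (i < d x)%N -> iter i f x \notin S.
  move=> xX; have [hS|/hasPn nS] := boolP (has (mem S) (traject f x #|V|)).
    have dV : (d x < #|V|)%N by rewrite /d -{2}(size_traject f x #|V|) -has_find.
    split; first by move: (nth_find x hS); rewrite nth_traject.
    by move=> i ix; move/(before_find x): (ix); rewrite nth_traject ?(ltn_trans ix) // => /negbT.
  have /trU : forall i, (i < #|V|)%N -> iter i f x \notin S.
    by move=> i iV; apply: nS; apply/trajectP; exists i.
  move/(_ xX)/card_uniqP; rewrite size_traject => cV.
  by have := max_card (mem (traject f x #|V|.+1)); rewrite cV ltnn.
(* [insub_bseq] falls back on the empty list when its argument is too long; a list without
   repetitions never is. *)
have LE x : x \in X ->
    val (insub_bseq #|V| (rev (traject f x (d x).+1))) = rev (traject f x (d x).+1).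
  move=> xX; rewrite /insub_bseq val_insubd size_rev.
  have [_ /(trU _ _ xX)/card_uniqP <-] := dS x xX.
  by rewrite max_card.
exists [ffun x => insub_bseq #|V| (rev (traject f x (d x).+1))].
apply/andP; split; apply/forall_inP => x xX; last first.
  apply/forall_inP => y yX; apply/implyP; apply: contraNT.
  move/pred0Pn => /= [z /andP[]]; rewrite !ffunE !mem_vpath !LE // !mem_rev.
  case/trajectP => i ix -> /trajectP [j jx] fE.
  have [||_ ->//] := sync _ _ _ _ xX yX _ _ fE.
    by move=> k kl; case: (dS x xX) => _; apply; lia.
  by move=> k kl; case: (dS y yX) => _; apply; lia.
rewrite ffunE /dipath LE //; have [lS iS] := dS x xX.
have := trU x (d x) xX iS; rewrite trajectS => tU.
have rE : rev (x :: traject f (f x) (d x)) =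
    iter (d x) f x :: rev (belast x (traject f (f x) (d x))).
  by rewrite lastI rev_rcons last_traject.
rewrite rE lS -rE rev_uniq tU -(last_traject f x) rev_path /=; apply/andP; split.
  apply/(pathP x) => i; rewrite size_traject => ix.
  rewrite -trajectS !nth_traject ?(ltnW ix) //= 1?ltnW //.
  case: (fX (iter i f x)) => [|_ []]; first by rewrite inE iS.
    (* A fixed point would put the walk at one vertex at times [i] and [i.+1], against [sync]; so
       every step follows an arc. *)
    move=> fE; have := sync i i.+1 x x xX xX; rewrite /= fE.
    by case=> //; [move=> k ki | move=> k ki|lia]; apply: iS; lia.
  by rewrite (set_nth_default (f x)) ?size_traject // nth_traject // -iterSr.
rewrite last_traject; move/(congr1 (last x)): rE.
by rewrite rev_cons last_rcons /= => <-.
Qed.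

Lemma gammoid_indepP e S R X :
  reflect (X \subset R /\ exists f, dual_matching e S X f) (gammoid_indep e S R X).
Proof.
apply: (iffP andP) => -[XR h]; split=> //.
  by case/existsP: h => L /dual_matching_of_linkage.
by case: h => f /linkage_of_dual_matching [L ?]; apply/existsP; exists L.
Qed.

Lemma gammoid_indep0 e S R : gammoid_indep e S R finset.set0.
Proof.
apply/gammoid_indepP; split; first exact: finset.sub0set.
exists [ffun u => u]; apply/dual_matchingP; split=> u; rewrite !ffunE ?inE.
  by split; [|left].
by move=> v _ _; rewrite ffunE.
Qed.

Lemma gammoid_indepS e S R X Y :
  X \subset Y -> gammoid_indep e S R Y -> gammoid_indep e S R X.
Proof.
move=> XY /gammoid_indepP [YR [f /dual_matchingP [fY finj]]].
apply/gammoid_indepP; split; first exact: fintype.subset_trans YR.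
exists f; apply/dual_matchingP; split=> // u /fY [fuY ?]; split=> //.
by apply: contraNN fuY; apply: (fintype.subsetP XY).
Qed.

(* Among the matchings of I take f agreeing most with a matching g of J. Then
   im g is contained in I :|: im f, so counting leaves a y in J outside
   I :|: im f. *)
Lemma gammoid_augment e S R I J :
  gammoid_indep e S R I -> gammoid_indep e S R J -> (#|I| < #|J|)%N ->
  exists2 y, y \in J :\: I & gammoid_indep e S R (y |: I).
Proof.
move=> /gammoid_indepP [IR [f0 f0I]] /gammoid_indepP [JR [g gJ]] IJ.
case: (@arg_maxnP _ f0 (fun f => dual_matching e S I f)
  (fun f => #|[set u | f u == g u]|) f0I) => f fI fmax.
have /dual_matchingP [fP finj] := fI; have /dual_matchingP [gP ginj] := gJ.
have gsub : g @: (~: S) \subset I :|: f @: (~: S).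
  apply/fintype.subsetP => z /imsetP [u uS ->]; apply: contraT.
  rewrite finset.inE negb_or => /andP[guI guf].
  (* As [g u] is outside both [I] and the image of [f], redirecting [u] to it gives a matching of
     [I] that agrees with [g] at one more vertex. *)
  pose f' := [ffun v => if v == u then g u else f v].
  have /fmax : dual_matching e S I f'.
    apply/dual_matchingP; split=> [v vS|v w vS wS]; rewrite !ffunE.
      by case: eqP => [->|_]; [split=> //; case: (gP u uS)|exact: fP].
    case: eqP => [->|_]; case: eqP => [-> //|_].
    - by move=> gf; rewrite gf imset_f in guf.
    - by move=> gf; rewrite -gf imset_f in guf.
    - exact: finj.
  rewrite /geq /= leqNgt => /negP []; apply: proper_card; apply/properP; split.
    by apply/fintype.subsetP => v; rewrite !finset.inE ffunE; case: (v == u) / eqP => [->|].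
  exists u; rewrite !finset.inE ?ffunE ?eqxx //.
  by apply: contraNneq guf => <-; rewrite imset_f.
have [/fintype.subsetP JI|] := boolP (J \subset I :|: f @: (~: S)); last first.
  case/subsetPn => y yJ; rewrite finset.inE negb_or => /andP[yI yf].
  exists y; first by rewrite finset.inE yI.
  apply/gammoid_indepP; split.
    by rewrite finset.subUset finset.sub1set IR (fintype.subsetP JR).
  exists f; apply/dual_matchingP; split=> // u uS; have [fuI fu] := fP u uS.
  split=> //; rewrite !finset.inE negb_or fuI andbT.
  by apply: contraNneq yf => <-; rewrite imset_f.
have cU X h : {in ~: S, forall u, h u \notin X} -> {in ~: S &, injective h} ->
    #|X :|: h @: (~: S)| = (#|X| + #|~: S|)%N.
  move=> hX hinj; rewrite cardsU card_in_imset //.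
  rewrite (_ : X :&: _ = finset.set0) ?cards0 ?subn0 //.
  apply/eqP; rewrite finset.setI_eq0 disjoint_sym; apply/pred0P => z /=.
  by apply/negP => /andP[/imsetP[u uS ->]]; rewrite (negbTE (hX u uS)).
(* Both unions are disjoint and both images have [#|~: S|] elements, so this inclusion would force
   [#|J| <= #|I|]. *)
have : J :|: g @: (~: S) \subset I :|: f @: (~: S).
  by rewrite finset.subUset gsub andbT; apply/fintype.subsetP.
move/subset_leq_card; rewrite !cU; first lia.
- by move=> u /fP [].
- exact: finj.
- by move=> u /gP [].
- exact: ginj.
Qed.

End GammoidMatroid.

(** * The greedy base *)

Section Greedy.
Context {V : finType}.
Implicit Types (indep : pred {set V}) (geR : rel V) (B Q R X Y : {set V}) (s : seq V).

Definition matroid indep : Prop :=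
  [/\ indep finset.set0, forall X Y, X \subset Y -> indep Y -> indep X &
      forall X Y, indep X -> indep Y -> (#|X| < #|Y|)%N ->
        exists2 y, y \in Y :\: X & indep (y |: X)].

Definition greedy indep B s : {set V} :=
  foldl (fun B x => if indep (x |: B) then x |: B else B) B s.

Lemma sub_greedy indep B s : B \subset greedy indep B s.
Proof.
elim: s B => [|x s IH] B //=; case: ifP => _ //.
by apply: fintype.subset_trans (IH _); rewrite finset.subsetUr.
Qed.

Lemma greedy_sub indep B s : greedy indep B s \subset B :|: [set x in s].
Proof.
elim: s B => [|x s IH] B /=; first exact: finset.subsetUl.
rewrite -/(greedy _ _ _); apply: fintype.subset_trans (IH _) _.
apply/fintype.subsetP => y; case: ifP => _; rewrite !finset.inE;
  by do ![case/orP]=> ->; rewrite ?orbT.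
Qed.

Lemma greedy_indep indep B s : indep B -> indep (greedy indep B s).
Proof. by elim: s B => [|x s IH] B //= iB; case: ifP => [/IH|_]; [|apply: IH]. Qed.

(* An element of X extending the greedy set would have extended the smaller
   set at hand when it was considered. *)
Lemma greedy_max indep s X : matroid indep -> indep X -> X \subset [set x in s] ->
  (#|X| <= #|greedy indep finset.set0 s|)%N.
Proof.
case=> i0 iS iA iX Xs; rewrite leqNgt; apply/negP.
case/(iA _ _ (greedy_indep s i0) iX) => y; rewrite finset.inE => /andP[yg yX].
have : y \in s by move/fintype.subsetP: Xs => /(_ y yX); rewrite finset.inE.
move=> ys; move: yg; case/splitPr: ys => s1 s2.
rewrite /greedy foldl_cat /= -!/(greedy _ _ _) => yg iy.
move: yg iy; case: ifPn => [_|/negP + _ iy].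
  by rewrite (fintype.subsetP (sub_greedy _ _ _)) // finset.setU11.
apply; apply: iS iy; apply: finset.setUS; exact: sub_greedy.
Qed.

Lemma mem_greedy indep s1 s2 x : x \notin s1 -> x \notin s2 ->
  (x \in greedy indep finset.set0 (s1 ++ x :: s2)) =
  indep (x |: greedy indep finset.set0 s1).
Proof.
move=> xs1 xs2; rewrite /greedy foldl_cat /= -!/(greedy _ _ _).
case: ifP => _; first by rewrite (fintype.subsetP (sub_greedy _ _ _)) // finset.setU11.
apply: contraNF xs2 => /(fintype.subsetP (greedy_sub _ _ _)).
rewrite !finset.inE => /orP[|//] /(fintype.subsetP (greedy_sub _ _ _)).
by rewrite !finset.inE (negbTE xs1).
Qed.

(* A largest independent set C between the greedy set of the filtered prefix and
   the prefix is no larger than the greedy set B of the prefix, so augmenting C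
   from x |: B can only add x. *)
Lemma greedy_filter indep (P : pred V) s x : matroid indep -> uniq s -> P x ->
  x \in greedy indep finset.set0 s -> x \in greedy indep finset.set0 (seq.filter P s).
Proof.
move=> mi + Px xg; have [i0 iS iA] := mi.
have : x \in s by move/(fintype.subsetP (greedy_sub _ _ _)): xg; rewrite !finset.inE.
move=> xs; move: xg; case/splitPr: xs => s1 s2 xg.
rewrite cat_uniq /= => /and3P[_ /norP[xs1 _] /andP[xs2 _]].
rewrite mem_greedy // in xg.
rewrite filter_cat /= Px mem_greedy ?mem_filter ?negb_and ?xs1 ?xs2 ?orbT //.
pose B' := greedy indep finset.set0 (seq.filter P s1).
pose good X := [&& indep X, B' \subset X & X \subset [set z in s1]].
have gB' : good B'.
  rewrite /good (greedy_indep _ i0) fintype.subxx /=.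
  apply: fintype.subset_trans (greedy_sub _ _ _) _; rewrite finset.set0U.
  by apply/fintype.subsetP => z; rewrite !finset.inE mem_filter => /andP[].
case: (@arg_maxnP _ B' good (fun X : {set V} => #|X|) gB') => C /and3P[iC BC Cs] Cmax.
have xB : x \notin greedy indep finset.set0 s1.
  by apply: contra xs1 => /(fintype.subsetP (greedy_sub _ _ _)); rewrite !finset.inE.
have [|y] := iA _ _ iC xg; first by rewrite cardsU1 xB add1n ltnS greedy_max.
rewrite !finset.inE => /andP[yC /orP[/eqP -> |yB] iy].
  by apply: iS iy; apply: finset.setUS.
have ys : y \in s1.
  by move/(fintype.subsetP (greedy_sub _ _ _)): yB; rewrite !finset.inE.
have /Cmax : good (y |: C).
  rewrite /good iy (fintype.subset_trans BC) ?finset.subsetUr //=.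
  by rewrite finset.subUset Cs finset.sub1set finset.inE ys.
by rewrite /geq /= cardsU1 yC add1n ltnn.
Qed.

Lemma OPT_indep indep geR Q : matroid indep -> indep (OPT indep geR Q).
Proof. by case=> i0 _ _; apply: greedy_indep. Qed.

Lemma OPT_sub indep geR Q : OPT indep geR Q \subset Q.
Proof.
apply: fintype.subset_trans (greedy_sub _ _ _) _; rewrite finset.set0U.
by apply/fintype.subsetP => x; rewrite finset.inE mem_sort mem_enum.
Qed.

(** Sorting [Y] amounts to filtering the sorted [R], which reduces the claim to [greedy_filter].
    Since [geR] is an order on [R] only, the sorting lemma is applied relative to [R]. *)
Lemma OPT_restrict indep geR R Y x : matroid indep -> total_order_on R geR ->
  Y \subset R -> x \in Y -> x \in OPT indep geR R -> x \in OPT indep geR Y.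
Proof.
move=> mi [_ _ tr tot] /fintype.subsetP YR xY xO.
rewrite /OPT -/(greedy _ _ _) (_ : sort geR (enum Y) = seq.filter (mem Y) (sort geR (enum R))).
  by apply: greedy_filter; rewrite // sort_uniq enum_uniq.
rewrite (filter_sort_in (P := mem R) tot tr); last first.
  by apply/allP => y; rewrite mem_enum.
congr sort; rewrite /enum_mem -filter_predI; apply: eq_filter => y /=.
by apply/idP/andP => [yY|[]//]; split=> //; exact: YR.
Qed.

End Greedy.

(** * Forbidden sets of the gammoid algorithm *)

Section GammoidForbidden.
Context {V : finType}.
Variables (e : rel V) (S R : {set V}) (rule : linkage_rule V) (geR : rel V).
Hypothesis hrule : is_canonical e S R rule.
Implicit Types (w : #|R|.-tuple V) (X Y : {set V}) (st : {set V} * {set vpath V}).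

Lemma gammoid_matroid : matroid (gammoid_indep e S R).
Proof.
split; [exact: gammoid_indep0 | exact: gammoid_indepS | exact: gammoid_augment].
Qed.

Lemma arrived_sub w t : w \in arrival_orders R -> arrived w t \subset R.
Proof.
rewrite finset.inE => /perm_mem wR; apply/fintype.subsetP => x.
by rewrite finset.inE => /mem_take; rewrite wR mem_enum.
Qed.

Lemma arrival_orders_uniq w : w \in arrival_orders R -> uniq w.
Proof. by rewrite finset.inE => /perm_uniq ->; rewrite enum_uniq. Qed.

Lemma mem_arrived w (i : 'I_#|R|) : tnth w i \in arrived w i.+1.
Proof.
rewrite finset.inE (take_nth (tnth w i)) ?size_tuple //.
by rewrite -tnth_nth mem_rcons mem_head.
Qed.

Local Notation indep := (gammoid_indep e S R).
Local Notation cpath X := (canonical_path e S rule X).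
Local Notation OPTt w i := (OPT indep geR (arrived w (nat_of_ord i).+1)).
Local Notation gstep := (gammoid_step e S rule geR).

Lemma cpath_OPT X : linkage e S (OPT indep geR X) (cpath (OPT indep geR X)).
Proof. exact/hrule/OPT_indep/gammoid_matroid. Qed.

Lemma cpath_OPT_end X v : v \in OPT indep geR X -> v \in cpath (OPT indep geR X) v.
Proof. by move=> vO; case/andP: (cpath_OPT X) => /forall_inP /(_ v vO) /dipath_end. Qed.

(** Invariant of the loop: the stored paths are exactly a linkage of the accepted set. The test of
    the algorithm makes each new path disjoint from the stored ones. *)
Lemma gammoid_steps_linkage w l st : w \in arrival_orders R -> st.1 \subset R ->
  (exists2 L, linkage e S st.1 L & st.2 = L @: st.1) ->
  let st' := foldl (gstep w) st l in
  st'.1 \subset R /\ exists2 L, linkage e S st'.1 L & st'.2 = L @: st'.1.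
Proof.
move=> wR; elim: l st => [|i l IH] st stR [L LX st2] /=; first by split; [|exists L].
apply: IH; rewrite /gammoid_step; case: ifPn => [/andP[]|//]; last by exists L.
  move=> iO _ /=; rewrite finset.subUset finset.sub1set stR andbT.
  by rewrite (fintype.subsetP (arrived_sub i.+1 wR)) // (fintype.subsetP (OPT_sub _ _ _) _ iO).
set r := tnth w i => rO dis /=; set Q := cpath _ r in dis *.
have rQ : r \in Q by exact: cpath_OPT_end.
have disL v : v \in st.1 -> forall x, x \in Q -> x \notin L v.
  by move=> vX x /(forall_inP dis) /forall_inP; apply; rewrite st2 imset_f.
(* The list [l] is arbitrary, so novelty of [r] comes from the test: had [r] been accepted, its
   stored path would already cover the end of [Q]. *)
have rX : r \notin st.1.
  apply/negP => rX; have := disL r rX r rQ.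
  by case/andP: LX => /forall_inP /(_ r rX) /dipath_end ->.
exists (fun v => if v == r then Q else L v).
  case/andP: LX => /forall_inP Lp /forall_inP Ld; apply/andP; split.
    apply/forall_inP => v; rewrite finset.in_setU1; case: eqP => [-> _|_ /= /Lp //].
    by case/andP: (cpath_OPT (arrived w i.+1)) => /forall_inP /(_ r rO).
  apply/forall_inP => u; rewrite finset.in_setU1; case: (u =P r) => [-> _|_ /= uX].
    apply/forall_inP => v; rewrite finset.in_setU1 (eq_sym r); case: (v =P r) => //= _ vX.
    by rewrite disjoint_subset; apply/fintype.subsetP => x /(disL v vX).
  apply/forall_inP => v; rewrite finset.in_setU1; case: (v =P r) => [-> _|_ /= vX].
    apply/implyP => _; rewrite disjoint_sym disjoint_subset.
    by apply/fintype.subsetP => x /(disL u uX).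
  exact: (forall_inP (Ld u uX)).
rewrite imsetU1 eqxx st2; congr (_ |: _); apply: eq_in_imset => v vX.
by case: eqP vX rX => // -> ->.
Qed.

Lemma gammoid_steps_mono w l st : st.1 \subset (foldl (gstep w) st l).1.
Proof.
elim: l st => [|i l IH] st //=; apply: fintype.subset_trans (IH _).
by rewrite /gammoid_step; case: ifP => _ //=; exact: finset.subsetUr.
Qed.

(** The first part shows that nothing in the sample is accepted; the second traces a blocking path
    back to the arrival that added it. *)
Lemma gammoid_steps_origin w l :
  let st := foldl (gstep w) (finset.set0, finset.set0) l in
  (forall x, x \in st.1 -> exists2 j, j \in l & x = tnth w j) /\
  (forall Q, Q \in st.2 -> exists2 j, j \in l &
     tnth w j \in OPTt w j /\ Q = cpath (OPTt w j) (tnth w j)).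
Proof.
elim/last_ind: l => [|l i [IH1 IH2]] /=; first by split=> x; rewrite finset.inE.
rewrite foldl_rcons {1 3}/gammoid_step; case: ifP => [/andP[iO _]|_] /=; split.
- move=> x; rewrite finset.in_setU1 => /orP[/eqP ->|/IH1 [j jl ->]].
    by exists i; rewrite // mem_rcons mem_head.
  by exists j; rewrite // mem_rcons inE jl orbT.
- move=> Q; rewrite finset.in_setU1 => /orP[/eqP ->|/IH2 [j jl jP]].
    by exists i; rewrite // mem_rcons mem_head.
  by exists j; rewrite // mem_rcons inE jl orbT.
- by move=> x /IH1 [j jl ->]; exists j; rewrite // mem_rcons inE jl orbT.
- by move=> Q /IH2 [j jl jP]; exists j; rewrite // mem_rcons inE jl orbT.
Qed.

Lemma gammoid_forbidden (K : realType) (p : K) :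
  has_forbidden_sets indep geR p (exchangeability e S R rule)
    (gammoid_alg e S R rule geR p).
Proof.
split.
- move=> s w wR; rewrite /= /gammoid_run; set l := [seq _ <- _ | _].
  have [] := @gammoid_steps_linkage w l (finset.set0, finset.set0) wR.
  + exact: finset.sub0set.
  + exists (fun=> nil_bseq _ _); last by rewrite imset0.
    by apply/andP; split; apply/forall_inP => v; rewrite finset.inE.
  + move=> XR [L LX _]; apply/andP; split=> //; apply/existsP.
    exists [ffun v => L v]; case/andP: LX => /forall_inP Lp /forall_inP Ld.
    apply/andP; split; apply/forall_inP => u uX; rewrite ffunE; first exact: Lp.
    by apply/forall_inP => v vX; rewrite ffunE; exact: (forall_inP (Ld u uX)).
- split=> // s w i wR iS; rewrite /= /gammoid_run; apply/negP.
  case/(proj1 (gammoid_steps_origin _ _)) => j; rewrite mem_filter => /andP[sj _].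
  move/(tuple_uniqP _ (arrival_orders_uniq wR)) => ij.
  by move: iS; rewrite ij ltnNge sj.
exists (fun X Y r => [set v in OPT indep geR X |
  ~~ [disjoint cpath (OPT indep geR X) v & cpath (OPT indep geR Y) r]]).
split.
  move=> X Y r YR rO XY; split.
    apply/fintype.subsetP => v; rewrite finset.inE => /andP[vO _].
    exact: (fintype.subsetP (OPT_sub _ _ _) _ vO).
  (* As [r] is not in [X], the path of [r] for [OPT(Y)] is one of the paths [Q] over which
     exchangeability takes its maximum at the independent set [OPT(X)]. *)
  have rR : r \in R :\: OPT indep geR X.
    rewrite finset.inE; apply/andP; split.
      apply/negP => /(fintype.subsetP (OPT_sub _ _ _)) /(fintype.subsetP XY).
      by rewrite !finset.inE eqxx.
    exact: (fintype.subsetP YR _ (fintype.subsetP (OPT_sub _ _ _) _ rO)).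
  have Qd : dipath e S r (cpath (OPT indep geR Y) r).
    by case/andP: (cpath_OPT Y) => /forall_inP /(_ r rO).
  rewrite /exchangeability.
  apply: leq_trans (leq_bigmax_cond _ (OPT_indep geR X gammoid_matroid)).
  apply: leq_trans (leq_bigmax_cond _ rR).
  by rewrite (bigD1 (canonical_path e S rule (OPT indep geR Y) r)) //= leq_maxl.
move=> s w i wR si iO nF; rewrite /= /gammoid_run.
set l := [seq _ <- _ | _].
have il : i \in l by rewrite mem_filter si mem_enum.
(* Positions are processed in increasing order, so those handled before [i] lie between [s] and [i],
   where the forbidden-set hypothesis applies. *)
have : pairwise (fun j k : 'I_#|R| => j < k)%N l.
  apply: (subseq_pairwise (filter_subseq _ _)).
  rewrite -(pairwise_map val ltn) val_enum_ord -sorted_pairwise ?iota_ltn_sorted //.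
  exact: ltn_trans.
have : {in l, forall j : 'I_#|R|, (s <= j)%N} by move=> j; rewrite mem_filter => /andP[].
case/splitPr: il => l1 l2 sl; rewrite pairwise_cat => /and3P[/allrelP lt _ _].
rewrite foldl_cat /=; apply: (fintype.subsetP (gammoid_steps_mono _ _ _)).
rewrite /gammoid_step iO /= ifT ?finset.setU11 //.
apply/forall_inP => x xQ; apply/forall_inP => Q.
case/(proj2 (gammoid_steps_origin _ _)) => j jl [jO ->].
have ji : (j < i)%N by apply: lt; rewrite // mem_head.
have /nF : (s <= j < i)%N by rewrite ji sl // mem_cat jl.
apply: contraNN => xj; rewrite finset.inE jO /=.
by apply/pred0Pn; exists x; rewrite /= xj xQ.
Qed.

End GammoidForbidden.

(** * Counting arrival orders *)

Section Orders.
Context {V : finType}.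
Implicit Types (X Y Z : {set V}) (G : {set V} -> {set V}) (w : seq V).

Lemma perm_enum_card X w : perm_eq w (enum X) -> size w = #|X|.
Proof. by move=> /perm_size; rewrite -cardE. Qed.

Lemma perm_enum_set X w : perm_eq w (enum X) -> [set x in w] = X.
Proof. by move=> /perm_mem h; apply/finset.setP => x; rewrite finset.inE h mem_enum. Qed.

(** Conditioning on the last entry, which drives the inductions that reveal an order from its
    end. *)
Lemma sum_permutations_rcons (A : nmodType) (phi : seq V -> A) X : X != finset.set0 ->
  \sum_(w <- permutations (enum X)) phi w =
  \sum_(x in X) \sum_(w <- permutations (enum (X :\ x))) phi (rcons w x).
Proof.
move=> X0; rewrite -big_enum /= -(big_allpairs_dep (h := fun x w => rcons w x)).
apply: perm_big; apply: uniq_perm; first exact: permutations_uniq.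
  apply: allpairs_uniq_dep => [|x _|[x w] [x' w'] _ _ /= /rcons_inj [-> ->] //].
    exact: enum_uniq.
  exact: permutations_uniq.
move=> w; rewrite mem_permutations; apply/idP/allpairsPdep.
  case/lastP: w => [|w x] wX.
    case/negP: X0; rewrite -(perm_enum_set wX); apply/eqP/finset.setP => x.
    by rewrite !finset.inE.
  have xX : x \in X by rewrite -mem_enum -(perm_mem wX) mem_rcons mem_head.
  exists x, w; split; rewrite ?mem_enum // mem_permutations.
  have wU : uniq (rcons w x) by rewrite (perm_uniq wX) enum_uniq.
  rewrite rcons_uniq in wU; case/andP: wU => xw wU.
  apply: uniq_perm; rewrite ?enum_uniq // => y; rewrite mem_enum !finset.inE.
  rewrite -(mem_enum X) -(perm_mem wX) mem_rcons inE.
  by case: eqP => // ->; rewrite (negbTE xw).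
case=> x [v []]; rewrite mem_enum mem_permutations => xX vX ->.
apply: uniq_perm; rewrite ?enum_uniq // ?rcons_uniq.
  by rewrite (perm_uniq vX) enum_uniq (perm_mem vX) mem_enum !finset.inE eqxx.
move=> y; rewrite mem_rcons inE (perm_mem vX) !mem_enum !finset.inE.
by case: eqP => // ->.
Qed.

(** Here [G] stands for F(-, Y, r) with Y and r fixed. The truncated [size w - s] makes the
    condition void when all of [w] lies in the sample. *)
Definition avoids s G x0 w :=
  all (fun j => nth x0 w j \notin G [set x in take j.+1 w]) (iota s (size w - s)).

Lemma avoids_rcons s G x0 w x : avoids s G x0 (rcons w x) =
  avoids s G x0 w && ((s <= size w)%N ==> (x \notin G [set y in rcons w x])).
Proof.
rewrite /avoids size_rcons; case: leqP => [sw|ws]; last first.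
  by rewrite andbT (eqP (ltnW ws : (size w - s)%N == 0%N)) (eqP (ws : (size w).+1 - s == 0)%N).
rewrite subSn // -addn1 iotaD all_cat subnKC //= andbT; congr andb.
  apply: eq_in_all => j; rewrite mem_iota subnKC // => /andP[_ jw].
  by rewrite nth_rcons jw -cats1 takel_cat.
by rewrite nth_rcons ltnn eqxx -(size_rcons w x) take_size.
Qed.

(* The truncated subtraction gives the positive part of 1 - k/j, for the
   1-based positions j = s+1, ..., m. *)
Definition survival (K : numFieldType) k s m : K :=
  \prod_(s <= j < m) ((j.+1 - k)%:R / j.+1%:R).

Lemma survival_small (K : numFieldType) k s m : (m <= s)%N -> survival K k s m = 1.
Proof. by move=> ms; rewrite /survival big_geq. Qed.

Lemma survival_ge0 (K : numFieldType) k s m : 0 <= survival K k s m.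
Proof. by apply: prodr_ge0 => j _; rewrite divr_ge0. Qed.

(** Whichever entry comes last, the revealed set is all of [X], so at most [k] choices of the last
    entry are bad; each other choice leaves an order of the remaining elements, handled by
    induction. *)
Lemma avoids_count (K : numFieldType) k s G x0 X :
  (forall Y, Y \subset X -> (#|G Y| <= k)%N) ->
  (#|X|)`!%:R * survival K k s #|X| <=
    \sum_(w <- permutations (enum X)) (avoids s G x0 w)%:R.
Proof.
move: {2}#|X| (erefl #|X|) => m; elim: m X => [|m IH] X Xm Gk.
  rewrite (finset.cards0_eq Xm) cards0 enum_set0 big_seq1 mul1r.
  by rewrite survival_small // /avoids sub0n.
have X0 : X != finset.set0 by rewrite -card_gt0 Xm.
rewrite sum_permutations_rcons // Xm.
have cX x : x \in X -> #|X :\ x| = m.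
  by move=> xX; have := cardsD1 x X; rewrite xX Xm; lia.
have IHx x : x \in X -> m`!%:R * survival K k s m <=
    \sum_(w <- permutations (enum (X :\ x))) (avoids s G x0 w)%:R.
  move=> xX; rewrite -(cX x xX); apply: IH; first exact: cX.
  by move=> Y YX; apply: Gk; apply: fintype.subset_trans YX (finset.subD1set _ _).
have sumE x : x \in X -> \sum_(w <- permutations (enum (X :\ x)))
      (avoids s G x0 (rcons w x))%:R =
    ((s <= m)%N ==> (x \notin G X))%:R *
    \sum_(w <- permutations (enum (X :\ x))) (avoids s G x0 w)%:R :> K.
  move=> xX; rewrite mulr_sumr big_seq [RHS]big_seq; apply: eq_bigr => w.
  rewrite mem_permutations => wX; rewrite avoids_rcons.
  rewrite (perm_enum_card wX) cX // (_ : [set y in rcons w x] = X).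
    by rewrite mulrC -natrM mulnb.
  apply/finset.setP => y; rewrite finset.inE mem_rcons inE (perm_mem wX) mem_enum.
  by rewrite !finset.inE; case: eqP => // ->.
rewrite (eq_bigr _ sumE); case: (leqP s m) => sm /=; last first.
  rewrite survival_small // mulr1 factS natrM -Xm mulr_natl -sumr_const.
  apply: ler_sum => x xX; rewrite mul1r; apply: le_trans (IHx x xX).
  by rewrite survival_small ?mulr1 // ltnW.
rewrite /survival big_nat_recr //= -/(survival K k s m).
apply: (@le_trans _ _ (\sum_(x in X :\: G X) (m`!%:R * survival K k s m))); last first.
  rewrite [leRHS](bigID (fun x => x \in G X)) /= [leRHS]addrC.
  rewrite -[leLHS]addr0 lerD //; last first.
    by apply: sumr_ge0 => x /andP[xX _]; rewrite mulr_ge0 // sumr_ge0.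
  rewrite big_mkcond [leRHS]big_mkcond /=; apply: ler_sum => x _.
  rewrite finset.inE andbC; case: (boolP (x \in X)) => //= xX.
  by case: ifP => // _; rewrite mul1r IHx.
rewrite sumr_const -[leRHS]mulr_natl factS natrM.
have -> : m.+1%:R * m`!%:R * (survival K k s m * ((m.+1 - k)%:R / m.+1%:R)) =
    (m.+1 - k)%:R * (m`!%:R * survival K k s m).
  by field; rewrite ?nat1r ?natr1 pnatr_eq0.
rewrite ler_wpM2r ?mulr_ge0 ?survival_ge0 // ler_nat.
have := Gk X (fintype.subxx X); have := subset_leq_card (finset.subsetIr X (G X)).
by rewrite cardsD Xm; lia.
Qed.

(** Entries after position [t] are stripped one by one. Once [t] is the last position, the set of
    the first [t.+1] entries is fixed, so the forbidden sets depend on the earlier prefixes only and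
    [avoids_count] applies. *)
Lemma select_count (K : numFieldType) k s t (F : {set V} -> {set V} -> {set V}) r X :
  r \in X -> (t < #|X|)%N ->
  (forall Y Z, Y \subset X -> r \in Y -> Z \subset Y :\ r -> (#|F Y Z| <= k)%N) ->
  (#|X|.-1)`!%:R * survival K k s t <=
    \sum_(w <- permutations (enum X))
      ((nth r w t == r) && avoids s (F [set x in take t.+1 w]) r (take t w))%:R.
Proof.
move: {2}#|X| (erefl #|X|) => m; elim: m X => [|m IH] X Xm rX; first by rewrite Xm.
rewrite Xm ltnS /= => tm Fk.
have X0 : X != finset.set0 by rewrite -card_gt0 Xm.
have cX x : x \in X -> #|X :\ x| = m.
  by move=> xX; have := cardsD1 x X; rewrite xX Xm; lia.
rewrite sum_permutations_rcons // (bigD1 r) //=; move: tm; rewrite leq_eqVlt => /orP[/eqP tm|tm].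
  rewrite -[leLHS]addr0 lerD //; last by apply: sumr_ge0 => x _; apply: sumr_ge0.
  have := @avoids_count K k s (F X) r (X :\ r).
  rewrite cX // -tm => /(_ _)/le_trans -> //.
    by move=> Y YX; apply: Fk.
  rewrite big_seq [leRHS]big_seq; apply: ler_sum => w; rewrite mem_permutations => wX.
  have sw : size w = t by rewrite (perm_enum_card wX) cX.
  rewrite nth_rcons sw ltnn !eqxx /= -cats1 take_cat sw ltnNge leqnSn /= subSnn.
  rewrite take_cat sw ltnn subnn take0 cats0 (_ : [set x in w ++ [:: r]] = X) //.
  apply/finset.setP => y; rewrite finset.inE mem_cat inE orbC (perm_mem wX) mem_enum.
  by rewrite !finset.inE; case: eqP => // ->.
(* Position [t] is not the last: the term with [r] last is dropped, and the other [m] choices of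
   last entry contribute [m.-1] factorial each. *)
rewrite -[leLHS]add0r lerD //; first by apply: sumr_ge0.
have -> : m`!%:R * survival K k s t =
    \sum_(x in X :\ r) (m.-1`!%:R * survival K k s t).
  rewrite sumr_const cX // -[RHS]mulr_natl mulrA -natrM.
  by case: (m) tm.
rewrite [leLHS](eq_bigl (fun x => (x \in X) && (x != r))); last first.
  by move=> x; rewrite !finset.inE andbC.
apply: ler_sum => x /andP[xX xr].
have := IH (X :\ x) (cX x xX); rewrite !finset.inE eq_sym xr rX cX // => /(_ isT tm) h.
apply: (le_trans (h _)).
  by move=> Y Z YX; apply: Fk; apply: fintype.subset_trans YX (finset.subD1set _ _).
rewrite big_seq [leRHS]big_seq; apply: ler_sum => w; rewrite mem_permutations => wX.
have sw : size w = m by rewrite (perm_enum_card wX) cX.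
by rewrite nth_rcons sw tm -cats1 !takel_cat // sw // ltnW.
Qed.

Lemma sum_arrival_orders (A : nmodType) (phi : seq V -> A) (X : {set V}) :
  \sum_(w in arrival_orders X) phi w = \sum_(w <- permutations (enum X)) phi w.
Proof.
rewrite -big_enum /= -(big_map val xpredT phi); apply: perm_big; apply: uniq_perm.
- by rewrite map_inj_uniq ?enum_uniq //; exact: val_inj.
- exact: permutations_uniq.
move=> w; rewrite mem_permutations; apply/mapP/idP.
  by case=> v; rewrite mem_enum finset.inE => vX ->.
move=> wX; have sw : size w == #|X| by rewrite (perm_enum_card wX).
by exists (Tuple sw); rewrite // mem_enum finset.inE.
Qed.

Lemma card_arrival_orders (X : {set V}) : #|arrival_orders X| = (#|X|)`!.
Proof.
rewrite -sum1_card (sum_arrival_orders (fun=> 1%N)) sum1_size size_permutations ?enum_uniq //.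
by rewrite -cardE.
Qed.

End Orders.

(** * The success polynomial *)

Section Survival.
Context {K : realType}.
Implicit Types (k n s t : nat) (x : K).

(** Here [t] is the arrival position of r and [s] the sample size; division by [n] averages over the
    position. *)
Definition success_poly k n : {poly K} :=
  \sum_(t < n) \sum_(s < t.+1)
    ('C(n, s)%:R * survival K k s t) *: ('X^s * (1 - 'X) ^+ (n - s)).

Lemma deriv_bernstein s m x :
  x * (('X^s * (1 - 'X) ^+ m)^`()).[x] =
  s%:R * (x ^+ s * (1 - x) ^+ m) - m%:R * (x ^+ s.+1 * (1 - x) ^+ m.-1).
Proof.
rewrite derivM derivXn deriv_exp derivB derivX -polyC1 derivC sub0r.
rewrite !(hornerD, hornerM, hornerMn, hornerN, horner_exp, hornerX, hornerC).
have xs : x * (x ^+ s.-1 *+ s) = s%:R * x ^+ s.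
  by case: s => [|s]; rewrite ?mulr0n ?mulr0 ?mul0r // mulrnAr -exprS mulr_natl.
rewrite mulrDr [x * (_ * _)]mulrA xs -[_ *+ m]mulr_natl mulN1r exprS.
by move: (x ^+ s) ((1 - x) ^+ m) (_ ^+ m.-1) m%:R s%:R => a b c d f; ring.
Qed.

Lemma survival_recl k s t : (s < t)%N ->
  survival K k s t = (s.+1 - k)%:R / s.+1%:R * survival K k s.+1 t.
Proof. by move=> st; rewrite /survival big_ltn. Qed.

(* The positive part of the s+1 term is at most the negative part of the s term. *)
Lemma deriv_bernstein_sum_le k n t x : (t <= n)%N -> 0 <= x <= 1 ->
  \sum_(s < t.+1) 'C(n, s)%:R * survival K k s t *
    ((s%:R - k%:R) * (x ^+ s * (1 - x) ^+ (n - s)) -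
     (n - s)%:R * (x ^+ s.+1 * (1 - x) ^+ (n - s).-1)) <=
  - ('C(n, t)%:R * (n - t)%:R * (x ^+ t.+1 * (1 - x) ^+ (n - t).-1)).
Proof.
move=> tn /andP[x0 x1].
pose a s : K := 'C(n, s)%:R * survival K k s t.
pose U s := a s * (s%:R - k%:R) * (x ^+ s * (1 - x) ^+ (n - s)).
pose T s := a s * (n - s)%:R * (x ^+ s.+1 * (1 - x) ^+ (n - s).-1).
have b0 i j : 0 <= x ^+ i * (1 - x) ^+ j by rewrite mulr_ge0 ?exprn_ge0 ?subr_ge0.
have a0 s : 0 <= a s by rewrite mulr_ge0 ?survival_ge0.
rewrite (eq_bigr (fun s : 'I__ => U s - T s)); last first.
  by move=> s _; rewrite /U /T /a; ring.
rewrite sumrB big_ord_recl [X in _ - X]big_ord_recr /= -/(a t).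
have -> : T t = 'C(n, t)%:R * (n - t)%:R * (x ^+ t.+1 * (1 - x) ^+ (n - t).-1).
  by rewrite /T /a survival_small ?mulr1.
(* [T t] is the right-hand side and [U 0] is nonpositive; it remains to compare [U s.+1] with [T s]
   term by term. *)
rewrite opprD addrA -[leRHS]add0r lerD2r subr_le0 -[leRHS]add0r lerD //.
  by rewrite /U sub0r mulrN mulNr oppr_le0 mulr_ge0 // mulr_ge0.
apply: ler_sum => -[s st] _; rewrite /= /bump /= add1n.
have -> : T s = 'C(n, s.+1)%:R * survival K k s.+1 t * (s.+1 - k)%:R *
    (x ^+ s.+1 * (1 - x) ^+ (n - s.+1)).
  rewrite /T /a survival_recl // subnS; congr (_ * _).
  have : 'C(n, s)%:R * (n - s)%:R = s.+1%:R * 'C(n, s.+1)%:R :> K.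
    by rewrite -!natrM mulnC -mul_bin_left.
  move=> E; transitivity ('C(n, s)%:R * (n - s)%:R * ((s.+1 - k)%:R / s.+1%:R * survival K k s.+1 t)).
    by ring.
  by rewrite E; field; rewrite ?nat1r ?natr1 pnatr_eq0.
rewrite /U /a ler_wpM2r // ler_wpM2l ?mulr_ge0 ?survival_ge0 //.
(* The coefficients now differ only in that one has the signed difference [s.+1 - k] and the other
   its positive part. *)
case: (leqP k s.+1) => ks; first by rewrite natrB.
by rewrite (le_trans _ (ler0n _ _)) // subr_le0 ler_nat ltnW.
Qed.

Lemma success_poly_deriv_le k n x : 0 <= x <= 1 ->
  x * (success_poly k n)^`().[x] - k%:R * (success_poly k n).[x] <= - (n%:R * x).
Proof.
move=> x01; have -> : x * (success_poly k n)^`().[x] - k%:R * (success_poly k n).[x] =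
    \sum_(t < n) \sum_(s < t.+1) 'C(n, s)%:R * survival K k s t *
    ((s%:R - k%:R) * (x ^+ s * (1 - x) ^+ (n - s)) -
     (n - s)%:R * (x ^+ s.+1 * (1 - x) ^+ (n - s).-1)).
  rewrite /success_poly (raddf_sum deriv) !horner_sum !mulr_sumr -sumrB; apply: eq_bigr => t _.
  rewrite (raddf_sum deriv) !horner_sum !mulr_sumr -sumrB; apply: eq_bigr => s _.
  rewrite /= derivZ !hornerZ mulrCA deriv_bernstein.
  rewrite !(hornerD, hornerM, hornerN, horner_exp, hornerX, hornerC); ring.
apply: (@le_trans _ _ (\sum_(t < n)
    - ('C(n, t)%:R * (n - t)%:R * (x ^+ t.+1 * (1 - x) ^+ (n - t).-1)))).
  by apply: ler_sum => t _; apply: deriv_bernstein_sum_le; rewrite // ltnW.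
rewrite sumrN lerN2; case: n => [|n]; first by rewrite big_ord0 mul0r.
rewrite le_eqVlt; apply/orP; left; apply/eqP.
(* After absorbing [n.+1 - t] into the binomial coefficient, the sum is [n.+1 * x] times the
   expansion of [(1 - x + x) ^+ n]. *)
have binom : \sum_(t < n.+1) ((1 - x) ^+ (n - t) * x ^+ t *+ 'C(n, t)) = 1.
  by rewrite -exprDn subrK expr1n.
transitivity (n.+1%:R * x * \sum_(t < n.+1) ((1 - x) ^+ (n - t) * x ^+ t *+ 'C(n, t))).
  by rewrite binom mulr1.
rewrite mulr_sumr.
apply: eq_bigr => -[t /= tn] _.
have -> : 'C(n.+1, t)%:R * (n.+1 - t)%:R = n.+1%:R * 'C(n, t)%:R :> K.
  by rewrite -!natrM mulnC -mul_bin_down.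
rewrite subSn // -[_ *+ 'C(n, t)]mulr_natl exprS /=.
by move: n.+1%:R 'C(n, t)%:R (x ^+ t) (_ ^+ (n - t)) => a b c d; ring.
Qed.

Lemma success_poly1_ge0 k n : 0 <= (success_poly k n).[1].
Proof.
rewrite horner_sum sumr_ge0 // => t _; rewrite horner_sum sumr_ge0 // => s _.
rewrite !(hornerZ, hornerD, hornerM, hornerN, horner_exp, hornerX, hornerC) subrr.
by rewrite !mulr_ge0 ?survival_ge0 ?exprn_ge0.
Qed.

(** * Integrating the differential inequality *)

Lemma is_derive_invXn k x : x != 0 ->
  is_derive x 1 (fun y => (y ^+ k)^-1) (- (k%:R / x ^+ k.+1)).
Proof.
move=> x0; have xk : x ^+ k != 0 by rewrite expf_neq0.
have dX : is_derive x 1 (fun y : K => y ^+ k) (k%:R * x ^+ k.-1).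
  have -> : (fun y : K => y ^+ k) = horner 'X^k by apply/funext => y; rewrite hornerXn.
  apply: is_derive_eq (is_derive_poly 'X^k x) _.
  by rewrite derivXn hornerMn hornerXn mulr_natl.
apply: (is_derive_eq (is_deriveV (f := fun y : K => y ^+ k) xk dX)); rewrite /GRing.scale /=.
case: k xk {dX} => [|k] xk; first by rewrite !mul0r mulr0 oppr0.
rewrite /= !exprS; field; rewrite x0 /= -?exprS.
by rewrite expf_neq0.
Qed.

(* p.[x] / x ^+ k - c * H x is nonincreasing on ]0, 1]. *)
Lemma poly_lower_bound (p : {poly K}) (H : K -> K) k (c : K) :
  (forall x, 0 <= x <= 1 -> x * p^`().[x] - k%:R * p.[x] <= - (c * x)) ->
  (forall x, 0 < x -> is_derive x 1 H (- (x ^+ k)^-1)) ->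
  H 1 = 0 -> 0 <= p.[1] ->
  forall x, 0 < x <= 1 -> c * (x ^+ k * H x) <= p.[x].
Proof.
move=> pd Hd H1 p1 a /andP[a0 a1].
pose phi := (fun x => p.[x] * (x ^+ k)^-1) - (fun x => c * H x).
have phid x : 0 < x -> is_derive x 1 phi
    (p^`().[x] / x ^+ k - p.[x] * (k%:R / x ^+ k.+1) + c / x ^+ k).
  move=> x0; have xn : x != 0 by rewrite gt_eqF.
  have d1 := is_deriveM (is_derive_poly p x) (is_derive_invXn k xn).
  have d2 := is_deriveZ c (Hd x x0).
  apply: is_derive_eq (is_deriveB d1 d2) _; rewrite /GRing.scale /=; ring.
have phiE x : phi x = p.[x] / x ^+ k - c * H x by [].
have phi1 : phi 1 = p.[1] by rewrite phiE H1 mulr0 subr0 expr1n invr1 mulr1.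
have : phi 1 <= phi a.
  apply: (@ler0_derive1_le_cc _ phi a 1); rewrite ?in_itv /= ?lexx ?a1 //.
  - by move=> x; rewrite in_itv /= => /andP[ax _]; case: (phid x (lt_trans a0 ax)).
  - move=> x; rewrite in_itv /= => /andP[ax x1]; have x0 := lt_trans a0 ax.
    have hd := phid x x0; rewrite derive1E derive_val {hd}.
    (* The hypothesis on [p] says precisely that this numerator is nonpositive. *)
    have -> : p^`().[x] / x ^+ k - p.[x] * (k%:R / x ^+ k.+1) + c / x ^+ k =
        (x * p^`().[x] - k%:R * p.[x] + c * x) / x ^+ k.+1.
      by rewrite exprS; field; rewrite expf_neq0 gt_eqF.
    rewrite pmulr_lle0 ?invr_gt0 ?exprn_gt0 // -lerBrDr sub0r.
    by apply: pd; rewrite !ltW.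
  - apply: derivable_within_continuous => x; rewrite in_itv /= => /andP[ax _].
    by case: (phid x (lt_le_trans a0 ax)).
rewrite phi1 phiE => /(le_trans p1); rewrite subr_ge0 ler_pdivlMr ?exprn_gt0 //.
by rewrite mulrAC mulrA.
Qed.

Lemma p_opt_gt0_le1 k : (0 < k)%N -> 0 < p_opt K k <= 1.
Proof.
rewrite /p_opt; case: eqP => [_ _|k1 k0].
  by rewrite div1r invr_gt0 expR_gt0 /= invf_le1 ?expR_gt0 // -[leLHS]expR0 ler_expR.
have k2 : (1 < k)%N by case: k k1 k0 => [|[]].
rewrite powR_gt0 ?ltr0n //= powRN invf_le1 ?powR_gt0 ?ltr0n //.
rewrite -[leLHS](powRr0 k%:R); apply: ler_powR; first by rewrite ler1n.
by rewrite div1r invr_ge0 subr_ge0 ler1n.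
Qed.

Lemma success_poly_opt k n : (0 < k)%N ->
  n%:R / alpha_opt K k <= (success_poly k n).[p_opt K k].
Proof.
move=> k0; have p01 := p_opt_gt0_le1 k0.
suff [H [Hd H1 Hp pk]] : exists H : K -> K, [/\
    forall x, 0 < x -> is_derive x 1 H (- (x ^+ k)^-1), H 1 = 0,
    H (p_opt K k) = 1 & p_opt K k ^+ k = (alpha_opt K k)^-1].
  have := poly_lower_bound (@success_poly_deriv_le k n) Hd H1 (success_poly1_ge0 k n) p01.
  by rewrite Hp mulr1 pk.
move: p01; rewrite /p_opt /alpha_opt; case: eqP => [-> _|k1 /andP[p0 _]].
  (* The integral of [1 / y] from [x] to 1. *)
  exists (- @ln K); split.
  - by move=> x x0; rewrite expr1; apply: is_deriveN; exact: is_derive1_ln.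
  - by rewrite fctE ln1 oppr0.
  - by rewrite fctE div1r lnV ?posrE ?expR_gt0 // expRK opprK.
  - by rewrite expr1 div1r.
have k2 : (1 < k)%N by case: k k1 k0 {p0} => [|[]].
have kn : k%:R - 1 != 0 :> K by rewrite subr_eq0 pnatr_eq1; apply/eqP.
(* The integral of [y ^- k] from [x] to 1. At the chosen p one has [p ^+ k.-1 = 1 / k], which makes
   it 1. *)
exists (fun x => (k%:R - 1)^-1 * ((x ^+ k.-1)^-1 - 1)); split.
- move=> x x0; have xn : x != 0 by rewrite gt_eqF.
  have d := is_deriveZ (k%:R - 1)^-1
    (is_deriveB (is_derive_invXn k.-1 xn) (is_derive_cst (1 : K) (x : K) (1 : K))).
  apply: is_derive_eq d _; rewrite /GRing.scale /= subr0 prednK //.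
  have -> : k.-1%:R = k%:R - 1 :> K by rewrite -subn1 natrB.
  by field; rewrite kn expf_neq0.
- by rewrite expr1n invr1 subrr mulr0.
- set p := _ `^ _; have -> : p ^+ k.-1 = k%:R^-1.
    rewrite -powR_mulrn ?powR_ge0 // -powRrM -subn1 natrB // mulNr.
    by rewrite div1r mulVf // powRN powRr1.
  by rewrite invrK mulVf.
- by rewrite -powR_mulrn ?powR_ge0 // -powRrM -powRN div1r mulNr mulrC.
Qed.

End Survival.

(** * Competitiveness from forbidden sets *)

Section Competitive.
Context {K : realType} {V : finType}.
Variables (R : {set V}) (indep : pred {set V}) (geR : rel V).
Hypotheses (mi : matroid indep) (hgeR : total_order_on R geR).

(** For fixed [s], the events that r arrives at position [t >= s] and no earlier arrival outside the
    sample is forbidden are disjoint in [t], and each forces the selection of r. *)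
Lemma forbidden_select_sum (p : K) k (A : algorithm K #|R|) r s :
  has_forbidden_sets indep geR p k A -> r \in OPT indep geR R ->
  (#|R|.-1)`!%:R * \sum_(t < #|R| | (s <= t)%N) survival K k s t <=
    \sum_(w in arrival_orders R) (r \in run A s w)%:R :> K.
Proof.
case=> _ _ [F [FP Fsel]] rO.
have rR : r \in R := fintype.subsetP (OPT_sub _ _ _) _ rO.
pose sel t (w : seq V) := (nth r w t == r) &&
  avoids s (fun X => F X [set x in take t.+1 w] r) r (take t w).
apply: (@le_trans _ _ (\sum_(t < #|R| | (s <= t)%N)
    \sum_(w in arrival_orders R) (sel t w)%:R)).
  rewrite mulr_sumr; apply: ler_sum => t _.
  rewrite (sum_arrival_orders (fun w => (sel t w)%:R)).
  apply: (@select_count _ K k s t (fun Y Z => F Z Y r)) => // Y Z YR rY ZY.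
  by case: (FP Z Y r YR (OPT_restrict mi hgeR YR rY rO) ZY).
rewrite exchange_big; apply: ler_sum => w wR.
have wU : uniq w by exact: arrival_orders_uniq wR.
have rw : r \in (w : seq V).
  by move: wR; rewrite finset.inE => /perm_mem ->; rewrite mem_enum.
have iR : (index r w < #|R|)%N by rewrite -[X in (_ < X)%N](size_tuple w) index_mem.
pose i := Ordinal iR.
have wi : tnth w i = r by rewrite (tnth_nth r) /= nth_index.
rewrite big_mkcond (bigD1 i) //= big1 ?addr0; last first.
  move=> t ti; case: ifP => // _; rewrite /sel; case: eqP => //= tr.
  case/eqP: ti; apply/val_inj => /=.
  by rewrite -tr index_uniq ?size_tuple.
case: ifP => // si; case: (boolP (sel _ _)) => //= /andP[_ av].
suff -> : r \in run A s w by [].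
rewrite -wi; apply: Fsel => //; rewrite wi.
  apply: (OPT_restrict mi hgeR (arrived_sub _ wR) _ rO).
  by rewrite -{1}wi mem_arrived.
move=> j /andP[sj ji]; move/allP: av => /(_ j).
rewrite mem_iota size_take size_tuple iR sj subnKC // ji => /(_ isT).
by rewrite nth_take // -tnth_nth take_takel // -/(arrived w _).
Qed.

Lemma binomial_prob_sum n (p : K) (U : set nat) : 0 <= p <= 1 ->
  binomial_prob n p U = (\sum_(s < n.+1) binomial_pmf n p s * (nat_of_ord s \in U)%:R)%:E.
Proof.
case/andP=> p0 p1; rewrite (@binomial_probE _ n p p0 p1) -sumEFin.
by apply: eq_bigr => s _; rewrite diracE.
Qed.

Lemma success_polyE k n (p : K) : (success_poly k n).[p] =
  \sum_(s < n.+1) binomial_pmf n p s * \sum_(t < n | (s <= t)%N) survival K k s t.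
Proof.
rewrite horner_sum; under eq_bigr => t _.
  (* The range of [s] is made independent of [t] so that the two sums can be exchanged. *)
  rewrite (big_ord_widen n.+1 (fun s => ('C(n, s)%:R * survival K k s t) *:
    ('X^s * (1 - 'X) ^+ (n - s)))) ?ltnS ?(ltnW (ltn_ord t)) //.
  rewrite horner_sum big_mkcond; over.
rewrite exchange_big; apply: eq_bigr => s _; rewrite mulr_sumr [RHS]big_mkcond.
apply: eq_bigr => t _; rewrite ltnS; case: ifP => // _.
rewrite !(hornerZ, hornerD, hornerM, hornerN, horner_exp, hornerX, hornerC).
by rewrite /binomial_pmf /unstable.onem -[in RHS]mulr_natl mulrAC.
Qed.

Lemma forbidden_select_prob (p : K) k (A : algorithm K #|R|) r : 0 <= p <= 1 ->
  has_forbidden_sets indep geR p k A -> r \in OPT indep geR R ->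
  (((success_poly k #|R|).[p] / #|R|%:R)%:E <= select_prob A r)%E.
Proof.
move=> p01 hA rO; have [_ [lawA _] _] := hA.
have rR : r \in R := fintype.subsetP (OPT_sub _ _ _) _ rO.
have n0 : (0 < #|R|)%N by rewrite card_gt0; apply/set0Pn; exists r.
rewrite /select_prob card_arrival_orders.
under eq_bigr do rewrite lawA binomial_prob_sum //.
rewrite sumEFin -EFinM lee_fin exchange_big /=.
rewrite success_polyE mulr_suml mulr_sumr; apply: ler_sum => s _.
rewrite -mulr_sumr (eq_bigr (fun w => (r \in run A s w)%:R)); last first.
  by move=> w _; rewrite mem_setE.
have := forbidden_select_sum s hA rO; set sum1 := \sum_(t < _ | _) _; set sum2 := \sum_(w in _) _.
(* The count has the factor (n-1)!, so dividing by the n! arrival orders leaves 1/n. *)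
have nE : (#|R|)`!%:R = #|R|%:R * (#|R|.-1)`!%:R :> K by rewrite -natrM; case: #|R| n0.
have -> : binomial_pmf #|R| p s * sum1 / #|R|%:R =
    (#|R|)`!%:R^-1 * (binomial_pmf #|R| p s * ((#|R|.-1)`!%:R * sum1)).
  by rewrite nE; field; rewrite !pnatr_eq0 -!lt0n fact_gt0 n0.
by move=> le12; rewrite !ler_wpM2l ?invr_ge0 ?binomial_pmf_ge0.
Qed.

Lemma forbidden_competitive k (A : algorithm K #|R|) : (0 < k)%N ->
  has_forbidden_sets indep geR (p_opt K k) k A ->
  prob_competitive indep geR A (alpha_opt K k).
Proof.
move=> k0 hA r rO; have /andP[p0 p1] := p_opt_gt0_le1 (K := K) k0.
have rR : r \in R := fintype.subsetP (OPT_sub _ _ _) _ rO.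
have n0 : (0 < #|R|)%N by rewrite card_gt0; apply/set0Pn; exists r.
apply: le_trans (forbidden_select_prob _ hA rO); last by rewrite ltW.
rewrite lee_fin ler_pdivlMr ?ltr0n // mulrC div1r.
exact: success_poly_opt.
Qed.

End Competitive.

Theorem theorem3 (K : realType) (V : finType) (e : rel V) (S R : {set V})
    (rule : linkage_rule V) (geR : rel V) (mu : nat)
    (hrule : is_canonical e S R rule)
    (hgeR : total_order_on R geR)
    (hmu : exchangeability e S R rule = mu) :
  (forall p : K, 0 <= p <= 1 ->
     has_forbidden_sets (gammoid_indep e S R) geR p mu
       (gammoid_alg e S R rule geR p)) /\
  ((1 <= mu)%N ->
     prob_competitive (gammoid_indep e S R) geR
       (gammoid_alg e S R rule geR (p_opt K mu)) (alpha_opt K mu)).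
Proof.
have forb (p : K) : has_forbidden_sets (gammoid_indep e S R) geR p mu
    (gammoid_alg e S R rule geR p) by rewrite -hmu; exact: gammoid_forbidden.
split=> [p _ //|mu1].
exact: (forbidden_competitive (gammoid_matroid _ _ _) hgeR mu1 (forb _)).
Qed.
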